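(* Let $(E,\mathcal{F})$ be a measurable space and let $\mu,\nu\in\mathcal{P}(E)$ be probability measures. Then $$\tfrac12\|\mu-\nu\|_{\mathrm{TV}}=\sup_{A\in\mathcal{F}}|\mu(A)-\nu(A)|\le\mathcal{T}(\mu,\nu).$$
   Context: The total variation norm of a finite signed measure $\eta$ is $\|\eta\|_{\mathrm{TV}}=\eta^+(E)+\eta^-(E)$ (Hahn–Jordan decomposition). For $\mu,\nu\in\mathcal{P}(E)$ the Hilbert projective metric is $\mathcal{H}(\mu,\nu)=\log\big(\beta(\mu,\nu)\beta(\nu,\mu)\big)\in[0,\infty]$, where $\beta(\mu,\nu)=\inf\{r>0: r\mu-\nu\text{ is a non-negative measure}\}$ with $\inf\emptyset=\infty$; equivalently $\mathcal{H}(\mu,\nu)=\log\big(\|\tfrac{d\mu}{d\nu}\|_\infty\|\tfrac{d\nu}{d\mu}\|_\infty\big)$ if $\mu\sim\nu$ with essentially bounded densities, and $\infty$ otherwise. $\mathcal{T}(\mu,\nu)=\tanh(\mathcal{H}(\mu,\nu)/4)$, with $\tanh(\infty)=1$. *)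

(* Defs.v *)
From HB Require Import structures.
From mathcomp Require Import all_boot all_order all_algebra.
From mathcomp Require Import all_classical all_reals all_analysis.

Set Implicit Arguments.
Unset Strict Implicit.
Unset Printing Implicit Defensive.

Import Order.TTheory GRing.Theory Num.Theory.
Import numFieldNormedType.Exports.

Local Open Scope classical_set_scope.
Local Open Scope ring_scope.
Local Open Scope ereal_scope.

Definition tv_norm (d : measure_display) (T : measurableType d) (R : realType)
    (eta : {charge set T -> \bar R}) : \bar R :=
  let PN := cid (Hahn_decomposition eta) in
  charge_variation (projT2 (cid (projT2 PN))) [set: T].

(* The norm does not depend on the Hahn decomposition chosen by [cid]. *)
Lemma tv_normE (d : measure_display) (T : measurableType d) (R : realType)
    (eta : {charge set T -> \bar R}) (P N : set T)
    (etaPN : hahn_decomposition eta P N) :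
  tv_norm eta = charge_variation etaPN [set: T].
Proof.
rewrite /tv_norm; set PN := cid _; set h := (X in charge_variation X).
have [eP eN] := Hahn_decomposition_uniq h etaPN measurableT.
rewrite /charge_variation /= !jordan_posE !cjordan_posE !jordan_negE.
by rewrite !cjordan_negE /crestr0 !mem_set// /crestr eP eN.
Qed.

(* The signed measure [r * mu - nu]. *)
Definition scale_sub (d : measure_display) (T : measurableType d)
    (R : realType) (r : R) (mu nu : {finite_measure set T -> \bar R}) :
    {charge set T -> \bar R} :=
  cadd (cscale r (charge_of_finite_measure mu))
       (copp (charge_of_finite_measure nu)).

(* [ereal_inf set0 = +oo], as in the convention [inf set0 = oo]. *)
Definition hilbert_beta (d : measure_display) (T : measurableType d)
    (R : realType) (mu nu : probability T R) : \bar R :=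
  ereal_inf [set r%:E | r in [set r : R | (0 < r)%R /\
    forall A, measurable A -> 0 <= scale_sub r mu nu A]].

(* For probability measures both factors are at least 1, so the product is
   never [0 * +oo] and [lne] is only used on [1, +oo]. *)
Definition hilbert_metric (d : measure_display) (T : measurableType d)
    (R : realType) (mu nu : probability T R) : \bar R :=
  lne (hilbert_beta mu nu * hilbert_beta nu mu).

Definition tanh (R : realType) (x : R) : R :=
  ((expR x - expR (- x)) / (expR x + expR (- x)))%R.

Definition tanhe (R : realType) (x : \bar R) : \bar R :=
  match x with
  | r%:E => (tanh r)%:E
  | +oo => 1
  | -oo => -1
  end.

Definition hilbert_tanh (d : measure_display) (T : measurableType d)
    (R : realType) (mu nu : probability T R) : \bar R :=
  tanhe (hilbert_metric mu nu * (4^-1)%:E).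

(* Main.v *)
(** Write [p] and [q] for the masses of [A] under [mu] and [nu]. If
  [nu <= a * mu] and [mu <= b * nu], evaluating at [A] and at its complement
  gives [p (1 - q) <= a b q (1 - p)], and symmetrically. Let [t ^ 2 = a b]. Since
    [(1 + (p - q)) ^ 2 = (1 - p - q) ^ 2 + 4 p (1 - q)] and
    [(1 - (p - q)) ^ 2 = (1 - p - q) ^ 2 + 4 q (1 - p)],
  it follows that [1 + (p - q) <= t (1 - (p - q))], that is
  [p - q <= (t - 1) / (t + 1)], which is [tanh (ln (a b) / 4)]. *)
Require Import Defs.
From mathcomp Require Import all_boot all_order all_algebra.
From mathcomp Require Import all_classical all_reals all_analysis.
From mathcomp Require Import ring lra.

Import Order.TTheory GRing.Theory Num.Theory.

Local Open Scope classical_set_scope.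
Local Open Scope ring_scope.
Local Open Scope ereal_scope.

Lemma sub_le_of_odds (R : realFieldType) (p q t : R) :
  (p <= 1 -> 0 <= q -> 1 <= t -> p * (1 - q) <= t ^+ 2 * (q * (1 - p)) ->
  (p - q) * (t + 1) <= t - 1)%R.
Proof.
move=> p1 q0 t1 odds.
suff : (1 + (p - q) <= t * (1 - (p - q)))%R by lra.
(* Otherwise both sides are nonnegative and can be squared. After expansion, [odds] absorbs the
   terms with factor 4, leaving [t ^+ 2 * y < y] for the square [y] of [1 - p - q], which is absurd
   since [1 <= t]. *)
rewrite leNgt; apply/negP => lt_t.
have t_ge0 : (0 <= t * (1 - (p - q)))%R by apply: mulr_ge0; lra.
have := sqr_ge0 (1 - p - q)%R.
have : ((t * (1 - (p - q))) ^+ 2 < (1 + (p - q)) ^+ 2)%R.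
  by rewrite ltr_pXn2r ?nnegrE //; lra.
have t2 : (1 <= t ^+ 2)%R by rewrite exprn_ege1.
have -> : ((1 + (p - q)) ^+ 2 = (1 - p - q) ^+ 2 + 4 * (p * (1 - q)))%R by ring.
have -> : ((t * (1 - (p - q))) ^+ 2
  = t ^+ 2 * (1 - p - q) ^+ 2 + 4 * (t ^+ 2 * (q * (1 - p))))%R by ring.
move: (t ^+ 2)%R ((1 - p - q) ^+ 2)%R t2 odds => x y x1 odds lt_xy y0.
have : (y <= x * y)%R by rewrite ler_peMl.
lra.
Qed.

Lemma tanh_expR (R : realType) (x : R) :
  (tanh x = (expR (x *+ 2) - 1) / (expR (x *+ 2) + 1))%R.
Proof.
rewrite /tanh mulr2n expRD expRN; have := expR_gt0 x.
move: (expR x) => s s0; field.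
by rewrite !gt_eqF //; have := mulr_gt0 s0 s0; lra.
Qed.

Lemma sub_le_tanh_odds (R : realType) (p q c : R) :
  (p <= 1 -> 0 <= q -> 1 <= c -> p * (1 - q) <= c * (q * (1 - p)) ->
  p - q <= tanh (ln c / 4))%R.
Proof.
move=> p1 q0 c1 odds; rewrite tanh_expR.
(* The argument is twice [ln c / 4], so [t] is the square root of [c]. *)
set t := expR _.
have t1 : (1 <= t)%R.
  by rewrite /t -expR0 ler_expR mulrn_wge0 // divr_ge0 // ln_ge0.
have t2 : (t ^+ 2 = c)%R.
  rewrite /t -expRM_natl -[RHS]lnK ?posrE; last lra.
  by congr expR; field.
rewrite ler_pdivlMr; last lra.
by apply: sub_le_of_odds => //; rewrite t2.
Qed.

Section hilbert_beta.
Context (d : measure_display) (T : measurableType d) (R : realType).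
Implicit Types mu nu : probability T R.

Lemma scale_sub_ge0 (r : R) mu nu (A : set T) : measurable A ->
  (0 <= scale_sub r mu nu A) = (nu A <= r%:E * mu A).
Proof.
move=> mA; rewrite /scale_sub /cadd /cscale /copp /=.
by rewrite sube_ge0 // ?fin_num_measure.
Qed.

(** Both total masses are 1, so testing an admissible [r] on the whole space forces [1 <= r]. *)
Lemma hilbert_beta_ge1 mu nu : 1 <= hilbert_beta mu nu.
Proof.
apply: le_ereal_inf_tmp => _ [r [_ rP] <-].
by have := rP _ measurableT; rewrite scale_sub_ge0// !probability_setT mule1.
Qed.

(** Every admissible [r] satisfies the bound at [A]; dividing by the mass of [A] under [mu] lets it
    pass to the infimum. *)
Lemma le_hilbert_beta {mu nu} {b : R} {A : set T} :
  hilbert_beta mu nu = b%:E -> measurable A ->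
  (fine (nu A) <= b * fine (mu A))%R.
Proof.
move=> betaE mA.
have le_r (r : R) : (forall B, measurable B -> 0 <= scale_sub r mu nu B) ->
    (fine (nu A) <= r * fine (mu A))%R.
  move=> /(_ _ mA); rewrite scale_sub_ge0//.
  by rewrite -(fineK (fin_num_measure mu A mA))
             -(fineK (fin_num_measure nu A mA)).
have := fine_ge0 (measure_ge0 mu A); rewrite le_eqVlt => /predU1P[muA0|muA_gt0].
  (* Division is impossible for a [mu]-null [A], but a finite infimum provides some admissible [r],
     which makes [A] null for [nu] too. *)
  have /ereal_inf_lt[_ [r [_ rP] <-] _] : hilbert_beta mu nu < +oo.
    by rewrite betaE ltry.
  by have := le_r r rP; rewrite -muA0 !mulr0.
rewrite -ler_pdivrMr// -lee_fin -betaE.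
apply: le_ereal_inf_tmp => _ [r [_ rP] <-].
by rewrite lee_fin ler_pdivrMr//; exact: le_r.
Qed.

Lemma abse_sub_le_hilbert_tanh mu nu (A : set T) : measurable A ->
  `|mu A - nu A| <= hilbert_tanh mu nu.
Proof.
move=> mA.
have mu1 := @probability_le1 _ _ _ mu A mA.
have nu1 := @probability_le1 _ _ _ nu A mA.
have p0 := fine_ge0 (measure_ge0 mu A); have q0 := fine_ge0 (measure_ge0 nu A).
have muC := probability_setC mu mA; have nuC := probability_setC nu mA.
have muE := fineK (fin_num_measure mu A mA).
have nuE := fineK (fin_num_measure nu A mA).
move: muC nuC mu1 nu1 p0 q0; rewrite -muE -nuE.
set p := fine (mu A); set q := fine (nu A).
rewrite !lee_fin -!EFinB => muC nuC p1 q1 p0 q0.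
rewrite /hilbert_tanh /hilbert_metric.
have := hilbert_beta_ge1 mu nu; have := hilbert_beta_ge1 nu mu.
have le1 : (`|p - q| <= 1)%R by rewrite ler_norml; apply/andP; split; lra.
(* If either factor is [+oo], the other is at least 1, so the metric is [+oo], its [tanhe] is 1, and
   [le1] suffices. *)
case bE: (hilbert_beta mu nu) => [b| |] //; last first.
  move=> a1 _; rewrite gt0_mulye ?(lt_le_trans _ a1)// /lne.
  by rewrite gt0_mulye ?lte_fin ?invr_gt0 ?ltr0n//= lee_fin.
case aE: (hilbert_beta nu mu) => [a| |] //; last first.
  move=> _ b1; rewrite gt0_muley ?(lt_le_trans _ b1)// /lne.
  by rewrite gt0_mulye ?lte_fin ?invr_gt0 ?ltr0n//= lee_fin.
rewrite !lee_fin => a1 b1.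
have ba1 : (1 <= b * a)%R by rewrite mulr_ege1.
rewrite -EFinM lne_EFin; last lra.
rewrite /= lee_fin.
have qp := le_hilbert_beta bE mA; have pq := le_hilbert_beta aE mA.
have := le_hilbert_beta bE (measurableC mA).
have := le_hilbert_beta aE (measurableC mA).
rewrite muC nuC /= -/p -/q in qp pq * => pqC qpC.
(* Product of [p <= a * q], taken at [A], and [1 - q <= b * (1 - p)], taken at its complement. *)
have h1 : (p * (1 - q) <= b * a * (q * (1 - p)))%R.
  have -> : (b * a * (q * (1 - p)) = (a * q) * (b * (1 - p)))%R by ring.
  by apply: ler_pM => //; lra.
have h2 : (q * (1 - p) <= b * a * (p * (1 - q)))%R.
  have -> : (b * a * (p * (1 - q)) = (b * p) * (a * (1 - q)))%R by ring.
  by apply: ler_pM => //; lra.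
rewrite ler_norml lerNl opprB; apply/andP; split; exact: sub_le_tanh_odds.
Qed.

End hilbert_beta.

(** Zero total mass gives the two Jordan parts equal mass, so half the norm is the mass of the
    positive part. The set [P] of a Hahn decomposition attains it. *)
Lemma half_tv_norm (d : measure_display) (T : measurableType d)
    (R : realType) (eta : {charge set T -> \bar R}) : eta [set: T] = 0 ->
  (2^-1)%:E * tv_norm eta
    = ereal_sup [set `|eta A| | A in [set A : set T | measurable A]].
Proof.
move=> eta0; have [P [N PN]] := Hahn_decomposition eta.
rewrite (tv_normE PN) /charge_variation /=.
have mP : measurable P by have [[]] := PN.
set pos := jordan_pos PN; set neg := jordan_neg PN.
have etaE A : measurable A -> eta A = pos A - neg A.
  by move=> mA; rewrite (jordan_decomp PN mA) /cadd /= cscaleN1.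
have fin_pos A : measurable A -> pos A \is a fin_num := fin_num_measure pos A.
have fin_neg A : measurable A -> neg A \is a fin_num := fin_num_measure neg A.
have neg_pos : neg [set: T] = pos [set: T].
  rewrite -[LHS]add0e -eta0 (etaE _ measurableT) subeK//; exact: fin_neg.
have -> : (2^-1)%:E * (pos [set: T] + neg [set: T]) = pos [set: T].
  rewrite neg_pos -(fineK (fin_pos _ measurableT)) -EFinD -EFinM.
  by congr EFin; field.
have posP : eta P = pos [set: T].
  by rewrite /pos jordan_posE cjordan_posE /crestr0 mem_set// /crestr setTI.
apply/eqP; rewrite eq_le; apply/andP; split.
  apply: ereal_sup_ubound; exists P => //.
  by rewrite posP gee0_abs// measure_ge0.
(* Both [pos A] and [neg A] lie between 0 and the common total mass, hence so does the absolute
   value of their difference. *)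
apply: ge_ereal_sup => _ [A mA <-]; rewrite etaE//.
have posA : pos A <= pos [set: T] by rewrite le_measure// inE.
have negA : neg A <= pos [set: T] by rewrite -neg_pos le_measure// inE.
have pos_ge0 := fine_ge0 (measure_ge0 pos A).
have neg_ge0 := fine_ge0 (measure_ge0 neg A).
move: posA negA; rewrite -(fineK (fin_pos _ mA)) -(fineK (fin_neg _ mA)).
rewrite -(fineK (fin_pos _ measurableT)) -EFinB /= !lee_fin => posA negA.
by rewrite ler_norml; apply/andP; split; lra.
Qed.

Theorem corollary5p2p1 (d : measure_display) (E : measurableType d)
    (R : realType) (mu nu : probability E R) :
  (2^-1)%:E * tv_norm (cadd (charge_of_finite_measure mu)
                            (copp (charge_of_finite_measure nu)))
    = ereal_sup [set `|mu A - nu A| | A in [set A : set E | measurable A]]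
  /\ ereal_sup [set `|mu A - nu A| | A in [set A : set E | measurable A]]
    <= hilbert_tanh mu nu.
Proof.
split.
  rewrite half_tv_norm//; change (mu [set: E] - nu [set: E] = 0).
  by rewrite !probability_setT subee.
apply: ge_ereal_sup => _ [A mA <-]; exact: abse_sub_le_hilbert_tanh.
Qed.
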